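(* Let $R$ be an integral domain, and let $S$ be a subset of $R$. Then $\mathrm{Int}(S,R)$ is a Furstenberg domain if and only if $R$ is a Furstenberg domain.
   Context: For an integral domain $R$ with quotient field $K$ and a subset $S$ of $R$, $\mathrm{Int}(S,R) := \{p(x) \in K[x] \mid p(S) \subseteq R\}$ is the ring of integer-valued polynomials of $R$ on $S$, a subring of $K[x]$. An integral domain is a Furstenberg domain if every nonzero nonunit is divisible by an irreducible.
   Formalization: The subset S is assumed nonempty: for S empty, Int(S,R) = K[x] is always Furstenberg, while R need not be (e.g. the ring of all algebraic integers), so the claim fails there. *)

(* Defs.v *)
From HB Require Import structures.
From mathcomp Require Import all_boot all_algebra.
From mathcomp Require Import boolp classical_sets.

Set Implicit Arguments.
Unset Strict Implicit.
Unset Printing Implicit Defensive.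

Import GRing.Theory.
Local Open Scope classical_set_scope.
Local Open Scope ring_scope.

Definition divides (D : idomainType) (a b : D) : Prop := exists c, b = a * c.

Definition irreducible_elt (D : idomainType) (a : D) : Prop :=
  [/\ a != 0, a \isn't a GRing.unit &
      forall b c : D, a = b * c -> b \is a GRing.unit \/ c \is a GRing.unit].

Definition furstenberg (D : idomainType) : Prop :=
  forall a : D, a != 0 -> a \isn't a GRing.unit ->
    exists2 q : D, irreducible_elt q & divides q a.

Definition int_valued (R : idomainType) (S : set R)
    (p : {poly {fraction R}}) : bool :=
  `[< [set p.[tofrac s] | s in S] `<=` range (@tofrac R) >].

Section IntRing.
Variables (R : idomainType) (S : set R).

Lemma int_valued_subring : subring_closed (int_valued S).
Proof.
split=> [|p q /asboolP Hp /asboolP Hq|p q /asboolP Hp /asboolP Hq];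
  apply/asboolP => _ [s Ss <-].
- by exists 1 => //; rewrite hornerC rmorph1.
- have [a _ Ea] := Hp _ (imageP _ Ss).
  have [b _ Eb] := Hq _ (imageP _ Ss).
  by exists (a - b) => //; rewrite rmorphB /= Ea Eb !hornerE.
- have [a _ Ea] := Hp _ (imageP _ Ss).
  have [b _ Eb] := Hq _ (imageP _ Ss).
  by exists (a * b) => //; rewrite rmorphM /= Ea Eb !hornerE.
Qed.

HB.instance Definition _ :=
  GRing.isSubringClosed.Build {poly {fraction R}} (int_valued S)
    int_valued_subring.

Record Int : Type := MkInt {
  Int_val : {poly {fraction R}};
  _ : int_valued S Int_val }.

HB.instance Definition _ := [isSub for Int_val].
HB.instance Definition _ := [Choice of Int by <:].
HB.instance Definition _ := [SubChoice_isSubComNzRing of Int by <:].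

(* Units are the elements invertible inside Int, which is stronger than
   invertibility of the underlying polynomial over the fraction field. *)
Definition Int_unit : {pred Int} :=
  fun f => `[< exists g : Int, g * f = 1 >].

Definition Int_inv (f : Int) : Int := xget f [set g | g * f = 1].

Lemma Int_mulVx : {in Int_unit, left_inverse 1 Int_inv *%R}.
Proof. by move=> f /asboolP [g gf]; rewrite /Int_inv; case: xgetP => [h _ //|/(_ g)]. Qed.

Lemma Int_unitPl (f g : Int) : g * f = 1 -> Int_unit f.
Proof. by move=> gf; apply/asboolP; exists g. Qed.

Lemma Int_invr_out : {in [predC Int_unit], Int_inv =1 id}.
Proof.
move=> f /asboolP nf; rewrite /Int_inv; case: xgetP => // h _ hf.
by case: nf; exists h.
Qed.

HB.instance Definition _ :=
  GRing.ComNzRing_hasMulInverse.Build Int Int_mulVx Int_unitPl Int_invr_out.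

Lemma Int_mulf_eq0 : GRing.integral_domain_axiom Int.
Proof.
move=> f g /(congr1 val); rewrite rmorphM rmorph0 => /eqP.
by rewrite mulf_eq0 -!(rmorph0 (val : Int -> _)) !(inj_eq val_inj).
Qed.

HB.instance Definition _ :=
  GRing.ComUnitRing_isIntegral.Build Int Int_mulf_eq0.

End IntRing.

(* Main.v *)
Require Import Defs.
From mathcomp Require Import all_boot all_algebra.
From mathcomp Require Import boolp classical_sets.
Local Open Scope classical_set_scope.

(** Evaluating at a point of S shows that the elements of Int(S,R) of degree 0
    are exactly the nonzero constants of R, and by additivity of degrees every
    factor in Int(S,R) of such a constant is again a constant of R.  So a
    constant is a unit, or irreducible, in R exactly when it is so in Int(S,R)
    ([unit_intC], [irreducible_intC]).  This gives one implication at once: an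
    irreducible divisor, in Int(S,R), of a constant lies in R.

    Conversely, let R be Furstenberg and let g be a nonunit divisor of least
    degree of the given f.  If g is constant, it has an irreducible divisor in
    R, which remains irreducible in Int(S,R).  If deg g > 0, then g is itself
    irreducible: two nonunit factors of g would both divide f, hence both have
    degree at least deg g, which is impossible as their degrees add up to
    deg g. *)

Set Implicit Arguments.
Unset Strict Implicit.
Unset Printing Implicit Defensive.

Import GRing.Theory.
Local Open Scope ring_scope.

Lemma divides_trans (D : idomainType) (a b c : D) :
  divides a b -> divides b c -> divides a c.
Proof. by move=> [x ->] [y ->]; exists (x * y); rewrite mulrA. Qed.

Section Constants.
Variables (R : idomainType) (S : set R).

Lemma int_valuedC (a : R) : int_valued S (tofrac a)%:P.
Proof. by apply/asboolP => _ [s _ <-]; exists a; rewrite // hornerC. Qed.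

Definition intC (a : R) : Int S := MkInt (int_valuedC a).

Lemma intCM (a b : R) : intC (a * b) = intC a * intC b.
Proof.
by apply: val_inj; rewrite [RHS](rmorphM (val : Int S -> _)) /= !rmorphM.
Qed.

Lemma intC0 : intC 0 = 0.
Proof. by apply: val_inj; rewrite /= !rmorph0. Qed.

Lemma intC1 : intC 1 = 1.
Proof. by apply: val_inj; rewrite /= !rmorph1. Qed.

Lemma intC_inj : injective intC.
Proof.
by move=> a b /(congr1 val) /= /polyC_inj /eqP; rewrite tofrac_eq => /eqP.
Qed.

Lemma intC_eq0 (a : R) : (intC a == 0) = (a == 0).
Proof. by rewrite -intC0 (inj_eq intC_inj). Qed.

Lemma val_Int_eq0 (f : Int S) : (val f == 0) = (f == 0).
Proof. by rewrite -(rmorph0 (val : Int S -> _)) (inj_eq val_inj). Qed.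

Lemma size_val_mul (f g : Int S) : f != 0 -> g != 0 ->
  size (val (f * g)) = (size (val f) + size (val g)).-1.
Proof. by move=> f0 g0; rewrite rmorphM size_mul // val_Int_eq0. Qed.

Hypothesis S_nonempty : S !=set0.

(** A constant polynomial equals its value at any point of S, and that value
    lies in R. *)
Lemma intC_of_size (f : Int S) :
  (size (val f) <= 1)%N -> exists a, f = intC a.
Proof.
move=> /size1_polyC fE; have [s Ss] := S_nonempty.
have /asboolP/(_ _ (imageP _ Ss)) [a _] := valP f.
by rewrite fE hornerC => aE; exists a; apply: val_inj; rewrite /= fE aE.
Qed.

(** Degrees add up to 0, so both factors have degree 0. *)
Lemma intC_factor (a : R) (f g : Int S) : a != 0 -> intC a = f * g ->
  exists b c, [/\ f = intC b, g = intC c & a = b * c].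
Proof.
move=> a0 aE.
have: f * g != 0 by rewrite -aE intC_eq0.
rewrite mulf_eq0 => /norP [f0 g0].
have := size_val_mul f0 g0.
rewrite -aE /= size_polyC tofrac_eq0 a0 => szE.
have sf : (0 < size (val f))%N by rewrite size_poly_gt0 val_Int_eq0.
have sg : (0 < size (val g))%N by rewrite size_poly_gt0 val_Int_eq0.
have [|b fE] := @intC_of_size f.
  move: szE sf sg; case: (size (val f)) => [|[|m]] //.
  by case: size => //= n; rewrite addnS.
have [|c gE] := @intC_of_size g.
  move: szE sf sg; case: (size (val f)) => [|m] //.
  by case: size => [|[|n]] //=; rewrite !addnS.
by exists b, c; split=> //; apply: intC_inj; rewrite intCM aE fE gE.
Qed.

(** A unit is a factor of the constant 1, so its inverse is a constant too. *)
Lemma unit_intC (a : R) : (intC a \is a GRing.unit) = (a \is a GRing.unit).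
Proof.
apply/idP/idP => /unitrPr [b ab]; apply/unitrPr.
  have [x [y [xE _ xy1]]] := intC_factor (oner_neq0 R) (etrans intC1 (esym ab)).
  by exists y; rewrite (intC_inj xE).
by exists (intC b); rewrite -intCM ab intC1.
Qed.

Lemma irreducible_intC (a : R) : irreducible_elt (intC a) <-> irreducible_elt a.
Proof.
split=> -[a0 aU irr]; split; move: a0 aU; rewrite ?intC_eq0 ?unit_intC //.
  move=> a0 aU b c aE.
  by have := irr _ _ (etrans (congr1 intC aE) (intCM b c)); rewrite !unit_intC.
move=> a0 aU f g /(intC_factor a0) [b [c [-> -> aE]]].
by rewrite !unit_intC; apply: irr.
Qed.

End Constants.

Lemma furstenberg_of_Int (R : idomainType) (S : set R) :
  S !=set0 -> furstenberg (Int S) -> furstenberg R.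
Proof.
move=> S0 F a a0 aU.
have [||q q_irr [c /(intC_factor S0 a0) [b [d [qE _ aE]]]]] := F (intC S a).
- by rewrite intC_eq0.
- by rewrite unit_intC.
by exists b; [apply/(irreducible_intC S0); rewrite -qE | exists d].
Qed.

(** Take g of least degree among the nonunit divisors of f: divisors of g divide
    f as well, so g is of least degree among its own nonunit divisors. *)
Lemma min_size_nonunit_divisor (R : idomainType) (S : set R) (f : Int S) :
  f \isn't a GRing.unit ->
  exists g : Int S, [/\ g \isn't a GRing.unit, divides g f &
    forall h : Int S, h \isn't a GRing.unit -> divides h g ->
      (size (val g) <= size (val h))%N].
Proof.
move=> fU.
pose P n := `[< exists g : Int S, [/\ g \isn't a GRing.unit, divides g f &
                                      size (val g) = n] >].
have exP : exists n, P n.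
  exists (size (val f)); apply/asboolP; exists f.
  by split=> //; exists 1; rewrite mulr1.
case: (ex_minnP exP) => n /asboolP [g [gU gf <-]] min_g.
exists g; split=> // h hU hg; apply: min_g; apply/asboolP.
by exists h; split=> //; apply: divides_trans gf.
Qed.

Lemma Int_furstenberg (R : idomainType) (S : set R) :
  S !=set0 -> furstenberg R -> furstenberg (Int S).
Proof.
move=> S0 F f f0 fU.
have [g [gU [e fE] min_g]] := min_size_nonunit_divisor fU.
have g0 : g != 0 by apply: contra_neq f0 => g0; rewrite fE g0 mul0r.
have [/(intC_of_size S0) [a aE]|sz_g] := leqP (size (val g)) 1.
  move: gU g0; rewrite aE (unit_intC S0) intC_eq0 => aU a0.
  have [q q_irr [c qc]] := F a a0 aU.
  exists (intC S q); first exact/(irreducible_intC S0).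
  by exists (intC S c * e); rewrite fE aE qc intCM mulrA.
exists g; last by exists e.
split=> // b c gE.
have [bU|bU] := boolP (b \is a GRing.unit); first by left.
have [cU|cU] := boolP (c \is a GRing.unit); first by right.
have: b * c != 0 by rewrite -gE.
rewrite mulf_eq0 => /norP [b0 c0].
have le_gb : (size (val g) <= size (val b))%N by apply: min_g => //; exists c.
have le_gc : (size (val g) <= size (val c))%N.
  by apply: min_g => //; exists b; rewrite mulrC.
(* With n the size of g, i.e. deg g + 1, this would give 2 n <= n + 1. *)
have := leq_add le_gb le_gc.
have szE : size (val g) = (size (val b) + size (val c)).-1.
  by rewrite {1}gE size_val_mul.
have := leqSpred (size (val b) + size (val c)); rewrite -szE => le1 le2.
have := leq_trans le2 le1.
by rewrite -[X in (_ <= X)%N]addn1 leq_add2l leqNgt sz_g.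
Qed.

Theorem proposition5p1 (R : idomainType) (S : set R) (S_nonempty : S !=set0) :
  furstenberg (Int S) <-> furstenberg R.
Proof.
by split; [apply: furstenberg_of_Int | apply: Int_furstenberg].
Qed.
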